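(* For every real $0<\varepsilon<1$ there exists $\beta>0$ such that the following holds. Let $c>0$ and let $n$ be a positive integer that is sufficiently large as a function of $\varepsilon$ and $c$. Let $G$ be a graph on $n$ vertices with $e(G)\geq cn^{1+\varepsilon}$. Then $G$ contains a regular subgraph $H$ on $m\geq n^{\beta}$ vertices such that $e(H)\geq \beta c m^{1+\varepsilon}$.
   Context: All graphs are finite and simple. $e(G)$ denotes the number of edges of $G$. A graph is regular if all its vertices have the same degree. *)

(* Defs.v *)
From mathcomp Require Import all_boot.

Set Implicit Arguments.
Unset Strict Implicit.
Unset Printing Implicit Defensive.

(* The vertices are drawn from an ambient finite type, and a
   graph carries its own vertex set, so that a graph and its (not necessarily
   induced or spanning) subgraphs live in the same type. *)
Record sgraph (T : finType) := SGraph {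
  vertices : {set T};
  edges : {set {set T}};
  edgesP : forall A : {set T},
    A \in edges -> A \subset vertices /\ #|A| = 2
}.

Definition subgraph (T : finType) (H G : sgraph T) : Prop :=
  vertices H \subset vertices G /\ edges H \subset edges G.

Definition degree (T : finType) (G : sgraph T) (v : T) : nat :=
  #|[set A in edges G | v \in A]|.

Definition regular (T : finType) (G : sgraph T) : Prop :=
  forall u v : T,
    u \in vertices G -> v \in vertices G -> degree G u = degree G v.

(* Main.v *)
(* Write wt X Y for the number (or total weight) of ordered pairs in X * Y that
   are edges, and pass first to a bipartite subgraph with half of the edges.

   A vertex set W maximising wt W W / |W|^(1 + eps/2) still has size and density
   polynomial in n, and every small subset of it is much sparser than W.  This
   sparsity bounds the number of edges at vertices of high degree, so W contains
   a subgraph whose degrees all lie between d/4 and K d, with d the average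
   degree of W.  Random sampling of vertices together with suitable edge weights
   makes this subgraph nearly regular, of weighted degree D proportional to d;
   the degree d is a power of n, so Chernoff bounds suffice.

   In a nearly regular weighted graph, take a smallest set W whose deficit
   D |W| - wt W W is at most a constant times D n^2 / |W|.  Minimality forces
   expansion, and together with sparsity of small sets this gives, after
   deleting a few vertices of the larger side, the cut condition
   wt X Y >= r (|X| + |Y| - m) with r proportional to D.  This is Ore's condition
   for the existence of an r-regular spanning subgraph of a balanced bipartite
   graph with sides of size m. *)
Require Import Defs.
From mathcomp Require Import all_boot all_order all_algebra.
From mathcomp Require Import reals sequences exp.
From mathcomp Require Import zify ring lra.

Set Implicit Arguments.
Unset Strict Implicit.
Unset Printing Implicit Defensive.

Import Order.TTheory GRing.Theory Num.Theory.

(** * Regular factors of bipartite graphs *)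

(** Arithmetic of uncrossing: two tight pairs, submodularity, and the condition for the two
    uncrossed pairs together leave no slack, so an uncrossed pair is tight. *)
Lemma uncross_tight (r1 r2 r3 r4 c1 c2 a1 a2 k : nat) :
  r1 <= c1 + k -> r2 <= c2 + k -> r1 + r2 = r3 + r4 ->
  r3 = a1 + k -> r4 = a2 + k -> c1 + c2 <= a1 + a2 -> r1 = c1 + k.
Proof. lia. Qed.

Section BipartiteFactor.
Variable V : finType.
Implicit Types (F : {set V * V}) (X Y P Q : {set V}).

Definition arcs F X Y : nat := \sum_(e in F) ((e.1 \in X) && (e.2 \in Y)).

(** Submodularity, which holds for each arc separately. *)
Lemma arcs_uncross F X1 Y1 X2 Y2 :
  arcs F (X1 :&: X2) (Y1 :|: Y2) + arcs F (X1 :|: X2) (Y1 :&: Y2)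
    <= arcs F X1 Y1 + arcs F X2 Y2.
Proof.
rewrite /arcs -!big_split /=; apply: leq_sum => e _; rewrite !inE.
by case: (_ \in X1); case: (_ \in X2); case: (_ \in Y1); case: (_ \in Y2).
Qed.

Lemma arcsD1l F X Y a : a \in X ->
  arcs F X Y = arcs F [set a] Y + arcs F (X :\ a) Y.
Proof.
move=> aX; rewrite /arcs -big_split /=; apply: eq_bigr => e _; rewrite !inE.
by case: eqP => [->|_]; rewrite ?aX //=; case: (_ \in Y).
Qed.

Lemma arcsD1r F X Y b : b \in Y ->
  arcs F X Y = arcs F X [set b] + arcs F X (Y :\ b).
Proof.
move=> bY; rewrite /arcs -big_split /=; apply: eq_bigr => e _; rewrite !inE.
by case: eqP => [->|_]; rewrite ?bY //=; case: (_ \in X).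
Qed.

Lemma arcs_suml F X Y : arcs F X Y = \sum_(a in X) arcs F [set a] Y.
Proof.
rewrite /arcs exchange_big /=; apply: eq_bigr => e _.
have [eX|eX] := boolP (e.1 \in X).
  rewrite (bigD1 e.1) //= !inE eqxx /= big1 ?addn0 // => a /andP[_ ane].
  by rewrite inE eq_sym (negbTE ane).
rewrite big1 // => a aX; rewrite inE; case: eqP => // ea.
by rewrite ea aX in eX.
Qed.

(** The term [r * #|P|] stands on the right to avoid truncated subtraction; the boolean form allows
    a minimal arc set to be extracted. *)
Definition ore_condition P Q (r : nat) F :=
  [forall X : {set V}, forall Y : {set V},
    (X \subset P) && (Y \subset Q) ==>
      (r * (#|X| + #|Y|) <= arcs F X Y + r * #|P|)].

Lemma ore_conditionP P Q r F :
  reflect (forall X Y, X \subset P -> Y \subset Q ->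
             r * (#|X| + #|Y|) <= arcs F X Y + r * #|P|)
          (ore_condition P Q r F).
Proof.
apply: (iffP forallP) => [H X Y XP YQ|H X].
  by have /forallP/(_ Y) := H X; rewrite XP YQ.
by apply/forallP => Y; apply/implyP => /andP[XP YQ]; apply: H.
Qed.

(* An inclusion-minimal arc set satisfying the condition is already regular:
   every arc lies in a tight pair (X, Y), tight pairs can be uncrossed, so a
   vertex a lies in a tight pair containing all its out-neighbours, and
   removing a from that pair bounds its degree by r. *)
Lemma regular_factor P Q (r : nat) (E : {set V * V}) :
  #|P| = #|Q| -> ore_condition P Q r E ->
  exists F : {set V * V}, [/\ F \subset E,
    forall e, e \in F -> (e.1 \in P) && (e.2 \in Q),
    forall a, a \in P -> arcs F [set a] Q = r &
    forall b, b \in Q -> arcs F P [set b] = r].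
Proof.
move=> PQ /minset_exists[F /minsetP[/ore_conditionP HF minF] FE].
have cutF e X Y : e \in F ->
    arcs F X Y = ((e.1 \in X) && (e.2 \in Y)) + arcs (F :\ e) X Y.
  move=> eF; rewrite /arcs (bigD1 e) //=; congr (_ + _).
  by apply: eq_bigl => x; rewrite !inE andbC.
have tight e : e \in F -> exists X Y, [/\ X \subset P, Y \subset Q,
    r * (#|X| + #|Y|) = arcs F X Y + r * #|P| & (e.1 \in X) && (e.2 \in Y)].
  move=> eF; have : ~~ ore_condition P Q r (F :\ e).
    apply/negP => /minF/(_ (subsetDl _ _)) eqF.
    by move: eF; rewrite -eqF !inE eqxx.
  rewrite negb_forall => /existsP[X]; rewrite negb_forall => /existsP[Y].
  rewrite negb_imply -ltnNge => /andP[/andP[XP YQ] lt].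
  have := HF _ _ XP YQ; have := cutF e X Y eF; exists X, Y.
  by case: andP H H0 => /= ? ? ?; split => //; lia.
have FPQ e : e \in F -> (e.1 \in P) && (e.2 \in Q).
  move=> /tight[X [Y [/subsetP XP /subsetP YQ _ /andP[eX eY]]]].
  by rewrite XP // YQ.
have degP a : a \in P -> arcs F [set a] Q = r.
  move=> aP; apply/eqP; rewrite eqn_leq; apply/andP; split; last first.
    have := HF [set a] Q; rewrite sub1set aP subxx cards1 PQ => /(_ isT isT).
    by rewrite mulnDr muln1 leq_add2r.
  rewrite leqNgt; apply/negP => lt_r.
  pose T (Z : {set V} * {set V}) := [&& Z.1 \subset P, Z.2 \subset Q, a \in Z.1 &
    r * (#|Z.1| + #|Z.2|) == arcs F Z.1 Z.2 + r * #|P|].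
  have [Z0 TZ0] : exists Z, T Z.
    have [e eF ea] : exists2 e, e \in F & e.1 = a.
      case: (pickP (fun e => (e \in F) && (e.1 == a))).
        by move=> e /andP[? /eqP ?]; exists e.
      move=> none; move: lt_r; rewrite /arcs big1 // => e eF; rewrite !inE.
      by have := none e; rewrite eF => /= ->.
    have [X [Y [XP YQ tXY /andP[eX _]]]] := tight e eF.
    by exists (X, Y); rewrite /T /= XP YQ -ea eX tXY /=.
  (* The second set is taken as large as possible: an arc out of [a] ending outside it has a tight
     pair, and uncrossing with that pair would enlarge it. *)
  case: (@arg_maxnP _ Z0 T (fun Z => #|Z.2|) TZ0) => -[X Y].
  move=> /and4P[/= XP YQ aX /eqP tXY] maxY.
  have sub_nb e : e \in F -> e.1 = a -> e.2 \in Y.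
    move=> eF ea; have [X' [Y' [XP' YQ' tXY' /andP[eX eY]]]] := tight e eF.
    have [//|eNY] := boolP (e.2 \in Y).
    have subP : X :|: X' \subset P by rewrite subUset XP.
    have subQ : Y :|: Y' \subset Q by rewrite subUset YQ.
    have subP' : X :&: X' \subset P by rewrite (subset_trans (subsetIl _ _)).
    have subQ' : Y :&: Y' \subset Q by rewrite (subset_trans (subsetIl _ _)).
    have h1 := HF _ _ subP' subQ; have h2 := HF _ _ subP subQ'.
    have un := arcs_uncross F X Y X' Y'.
    have cX := cardsUI X X'; have cY := cardsUI Y Y'.
    have TU : T (X :&: X', Y :|: Y').
      rewrite /T /= subP' subQ inE aX -ea eX /=; apply/eqP.
      have eqr : r * (#|X :&: X'| + #|Y :|: Y'|) + r * (#|X :|: X'| + #|Y :&: Y'|)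
         = r * (#|X| + #|Y|) + r * (#|X'| + #|Y'|).
        rewrite -!mulnDr; congr (_ * _).
        by rewrite [RHS]addnACA -cX -cY addnACA [X in X + _ = _]addnC.
      exact: uncross_tight h1 h2 eqr tXY tXY' un.
    have /= := maxY _ TU; have : Y \proper Y :|: Y'.
      rewrite properEneq subsetUl andbT; apply: contraNneq eNY => ->.
      by rewrite inE eY orbT.
    by move=> /proper_card; rewrite ltnNge => /negP.
  have aY : arcs F [set a] Y = arcs F [set a] Q.
    apply: eq_bigr => e eF; rewrite !inE; case: eqP => //= ea.
    by rewrite sub_nb //; have /andP[_ ->] := FPQ e eF.
  have := HF (X :\ a) Y; rewrite (subset_trans (subsetDl _ _) XP) YQ.
  move=> /(_ isT isT); apply/negP.
  rewrite -ltnNge -(ltn_add2l r) -mulnS -(addSn #|X :\ a|).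
  have -> : #|X :\ a|.+1 = #|X| by rewrite (cardsD1 a X) aX.
  by rewrite tXY (arcsD1l F Y aX) aY addnA ltn_add2r ltn_add2r.
(* There are [r * #|P|] arcs in all, and the pair [(P, Q :\ b)] accounts for at least
   [r * (#|Q| - 1)] of them. The pair [(P, [set b])] gives the reverse bound. *)
exists F; split=> // b bQ; apply/eqP; rewrite eqn_leq; apply/andP; split.
  have H := HF P (Q :\ b) (subxx _) (subsetDl _ _).
  have := arcsD1r F P bQ; rewrite arcs_suml (eq_bigr (fun=> r)) //.
  rewrite sum_nat_const mulnC => eq1.
  rewrite -(leq_add2r (r * #|Q :\ b| + r * #|P|)) [leqRHS]addnA -mulnS.
  have -> : #|Q :\ b|.+1 = #|P| by rewrite PQ (cardsD1 b Q) bQ.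
  by rewrite [X in _ <= X + _]eq1 -addnA leq_add2l -mulnDr [_ + #|P|]addnC.
have := HF P [set b]; rewrite subxx sub1set bQ cards1 => /(_ isT isT).
by rewrite mulnDr muln1 addnC leq_add2r.
Qed.
End BipartiteFactor.

Local Open Scope ring_scope.

(** * Random sampling of vertices *)

(** From [expR (- x) >= 1 - x], and because [(1 - x) * (1 + x + 2 * x ^+ 2)] equals
    [1 + x ^+ 2 * (1 - 2 * x)]. *)
Lemma expR_le_quadratic (R : realType) (x : R) :
  x <= 2^-1 -> expR x <= 1 + x + 2 * x ^+ 2.
Proof.
move=> x2; rewrite -[x in expR x]opprK expRN.
have h : 0 < 1 - x by lra.
apply: (@le_trans _ _ (1 - x)^-1).
  rewrite lef_pV2 ?posrE ?expR_gt0 //.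
  by have := expR_ge1Dx (- x).
rewrite -[_^-1]mul1r ler_pdivrMr //; have := sqr_ge0 x; rewrite !expr2; nra.
Qed.

Section Sampling.
Variables (R : realType) (V : finType) (p : V -> R).
Hypothesis p01 : forall v, 0 <= p v <= 1.

(** The probability of drawing [S] when each [v] is chosen independently with probability [p v]. *)
Definition sample_weight (S : {set V}) : R :=
  \prod_v (if v \in S then p v else 1 - p v).

Lemma sample_weight_ge0 S : 0 <= sample_weight S.
Proof.
by apply: prodr_ge0 => v _; case: ifP => _; have := p01 v; lra.
Qed.

Lemma sum_sample_weight : \sum_(S : {set V}) sample_weight S = 1.
Proof.
rewrite -bigA_distr /= big1 // => v _; lra.
Qed.

(** The expectation factors over the vertices, and [1 + z <= expR z] applies to each factor after a
    quadratic bound on the exponential. *)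
Lemma sample_mgf (f : V -> R) (t : R) :
  (forall v, 0 <= f v <= 1) -> `|t| <= 2^-1 ->
  \sum_(S : {set V}) sample_weight S * expR (t * \sum_(v in S) f v)
    <= expR ((t + 2 * t ^+ 2) * \sum_v p v * f v).
Proof.
move=> f01 t2.
rewrite (eq_bigr (fun S : {set V} =>
    \prod_v (if v \in S then p v * expR (t * f v) else 1 - p v))); last first.
  move=> S _; rewrite mulr_sumr big_mkcond expR_sum -big_split /=.
  by apply: eq_bigr => v _; case: ifP => _ //; rewrite expR0 mulr1.
rewrite -bigA_distr /= mulr_sumr expR_sum.
apply: ler_prod => v _; have /andP[f0 f1] := f01 v; have /andP[p0 p1] := p01 v.
rewrite addr_ge0 ?mulr_ge0 ?expR_ge0 ?subr_ge0 //=.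
apply: le_trans (expR_ge1Dx _).
move: t2; rewrite ler_norml => /andP[t2 t2'].
have e1 : expR (t * f v) <= 1 + (t + 2 * t ^+ 2) * f v.
  apply: le_trans (expR_le_quadratic _) _; first nra.
  have : (t * f v) ^+ 2 <= t ^+ 2 * f v.
    by rewrite exprMn ler_wpM2l ?sqr_ge0 // expr2 ler_piMr.
  lra.
have := ler_wpM2l p0 e1; nra.
Qed.

(** Chernoff bounds for both tails and a union bound over [J]. Deviations are measured against the
    common bound [M], so small means do no harm. *)
Lemma sampling (J : finType) (f : J -> V -> R) (M eta : R) :
  (forall j v, 0 <= f j v <= 1) -> (forall j, \sum_v f j v <= M) ->
  0 < eta <= 1 -> 2 * #|J|%:R * expR (- (eta ^+ 2 * M / 8)) < 1 ->
  exists S : {set V}, forall j,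
    `|\sum_(v in S) f j v - \sum_v p v * f j v| <= eta * M.
Proof.
move=> f01 fM /andP[eta0 eta1] small.
pose mean j := \sum_v p v * f j v.
pose bad (S : {set V}) j := `|\sum_(v in S) f j v - mean j| > eta * M.
case: (pickP (fun S : {set V} => [forall j, ~~ bad S j])) => [S /forallP H|H].
  by exists S => j; rewrite leNgt; apply: H.
exfalso; move: small; apply/negP; rewrite -leNgt.
(* This [t] minimises [2 * t ^+ 2 * M - t * eta * M], with value [- (eta ^+ 2 * M / 8)]. *)
pose t := eta / 4.
have meanM j : mean j <= M.
  apply: le_trans (fM j); apply: ler_sum => v _.
  by have /andP[? ?] := f01 j v; have /andP[? ?] := p01 v; nra.
pose X (s : R) (S : {set V}) j :=
  expR (s * (\sum_(v in S) f j v - mean j) - t * eta * M).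
have tail s j : `|s| = t ->
    \sum_(S : {set V}) sample_weight S * X s S j <= expR (- (eta ^+ 2 * M / 8)).
  move=> sE; have st : s ^+ 2 = t ^+ 2 by rewrite -sE real_normK ?num_real.
  have := @sample_mgf (f j) s (f01 j); rewrite sE => /(_ _)/wrap[].
    by rewrite /t; lra.
  rewrite -/(mean j) => H1.
  rewrite (eq_bigr (fun S : {set V} => sample_weight S * expR (s * \sum_(v in S) f j v)
     * expR (- (s * mean j) - t * eta * M))); last first.
    by move=> S _; rewrite -mulrA -expRD /X mulrBr addrA.
  rewrite -mulr_suml; apply: le_trans (ler_wpM2r (expR_ge0 _) H1) _.
  rewrite -expRD ler_expR st mulrDl -!addrA [s * mean j + _]addrCA addrA.
  have := ler_wpM2l (sqr_ge0 t) (meanM j); rewrite /t.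
  by move=> h; rewrite -subr_ge0; nra.
(* Markov's inequality: every [S] is assumed to be bad for some [j], and then one of the two
   exponentials of that [j] is at least 1. *)
have X_ge1 S : 1 <= \sum_j (X t S j + X (- t) S j).
  have /forallPn[j] := negbT (H S); rewrite negbK /bad => bj.
  rewrite (bigD1 j) //= -[X in X <= _]addr0 lerD //; last first.
    by apply: sumr_ge0 => k _; rewrite addr_ge0 ?expR_ge0.
  have t0 : 0 < t by rewrite /t; lra.
  have ge1 x : eta * M < x -> 1 <= expR (t * x - t * eta * M).
    move=> lt; apply: le_trans (expR_ge1Dx _); nra.
  move: bj; rewrite ltr_normr /X => /orP[]/ge1 h.
    by rewrite -[X in X <= _]addr0 lerD ?expR_ge0.
  by rewrite mulNr -mulrN -[X in X <= _]add0r lerD ?expR_ge0.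
rewrite -[X in X <= _]sum_sample_weight.
apply: (@le_trans _ _ (\sum_(S : {set V})
    sample_weight S * \sum_j (X t S j + X (- t) S j))).
  by apply: ler_sum => S _; rewrite ler_peMr ?sample_weight_ge0.
under eq_bigr do rewrite mulr_sumr.
set q := expR (- _); have -> : 2 * #|J|%:R * q = \sum_(j : J) (q + q).
  by rewrite sumr_const -mulr_natr; ring.
rewrite exchange_big /=; apply: ler_sum => j _; under eq_bigr do rewrite mulrDr.
by rewrite big_split /= lerD // tail ?normrN // ger0_norm // /t; lra.
Qed.
End Sampling.

(** * Nearly regular weighted graphs *)

Lemma exists_subset_card (T : finType) (A : {set T}) (k : nat) :
  (k <= #|A|)%N -> exists2 B : {set T}, B \subset A & #|B| = k.
Proof.
move=> kA; exists [set x in take k (enum A)].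
  by apply/subsetP => x; rewrite inE => /mem_take; rewrite mem_enum.
rewrite cardsE (card_uniqP _) ?take_uniq ?enum_uniq // size_take -cardE.
by case: ltngtP kA.
Qed.

Section WeightedGraph.
Variables (R : realType) (V : finType) (w : V -> V -> R).
Hypothesis w_sym : forall x y, w x y = w y x.
Hypothesis w01 : forall x y, 0 <= w x y <= 1.
Implicit Types (A P Q S T U W X Y Z : {set V}).

Definition wt X Y : R := \sum_(x in X) \sum_(y in Y) w x y.

Lemma wtC X Y : wt X Y = wt Y X.
Proof.
by rewrite /wt exchange_big /=; apply: eq_bigr => y _; apply: eq_bigr => x _.
Qed.

Lemma wt_ge0 X Y : 0 <= wt X Y.
Proof.
by apply: sumr_ge0 => x _; apply: sumr_ge0 => y _; have /andP[] := w01 x y.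
Qed.

Lemma wt1 x Y : wt [set x] Y = \sum_(y in Y) w x y.
Proof. by rewrite /wt big_set1. Qed.

Lemma wt_suml X Y : wt X Y = \sum_(x in X) wt [set x] Y.
Proof. by apply: eq_bigr => x _; rewrite wt1. Qed.

Lemma wtDl Z X Y : Z \subset X -> wt X Y = wt Z Y + wt (X :\: Z) Y.
Proof. by move=> ZX; rewrite {1}/wt (big_setID Z) /= (setIidPr ZX). Qed.

Lemma wtDr Z X Y : Z \subset Y -> wt X Y = wt X Z + wt X (Y :\: Z).
Proof. by move=> ZY; rewrite wtC (wtDl _ ZY) wtC [X in _ + X]wtC. Qed.

Lemma wtS X X' Y Y' : X \subset X' -> Y \subset Y' -> wt X Y <= wt X' Y'.
Proof.
move=> XX' YY'; rewrite (wtDl _ XX') (wtDr _ YY') -addrA lerDl.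
by rewrite addr_ge0 ?wt_ge0.
Qed.

Lemma wt_le c X Y : (forall x, x \in X -> wt [set x] Y <= c) ->
  wt X Y <= c * #|X|%:R.
Proof.
by move=> H; rewrite wt_suml mulr_natr -sumr_const; apply: ler_sum.
Qed.

Lemma wt_ge c X Y : (forall x, x \in X -> c <= wt [set x] Y) ->
  c * #|X|%:R <= wt X Y.
Proof.
by move=> H; rewrite wt_suml mulr_natr -sumr_const; apply: ler_sum.
Qed.

Lemma cardsDR X Z : Z \subset X -> #|X|%:R = #|Z|%:R + #|X :\: Z|%:R :> R.
Proof. by move=> ZX; rewrite -(cardsID Z X) (setIidPr ZX) natrD. Qed.

Lemma wtDD Z X : Z \subset X ->
  wt X X = wt Z Z + 2 * wt Z (X :\: Z) + wt (X :\: Z) (X :\: Z).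
Proof.
move=> ZX; rewrite (wtDl _ ZX) 2!(wtDr _ ZX) [wt (X :\: Z) Z]wtC; ring.
Qed.

Lemma wtUU X Y : X \subset ~: Y ->
  wt (X :|: Y) (X :|: Y) = wt X X + 2 * wt X Y + wt Y Y.
Proof.
move=> XY; rewrite (@wtDD X) ?subsetUl // setDUl setDv set0U.
suff -> : Y :\: X = Y by [].
by apply/setDidPl; rewrite disjoint_sym disjoints_subset.
Qed.

(** In a bipartite graph [2 * wt (P :\: X) Y] is the weight inside the union of [P :\: X] and [Y].
    If that union is sparse, the lower degree bound on [Y] wins; otherwise the upper degree bound on
    [Q :\: Y] does. *)
Lemma half_ore D P Q X Y : 0 <= D -> X \subset P -> Y \subset Q -> #|P| = #|Q| ->
  (forall t, t \in Q -> 3 / 8 * D <= wt [set t] P <= D) ->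
  2 * wt (P :\: X) Y <= D / 4 * (#|P :\: X|%:R + #|Y|%:R) \/
  2 * wt (P :\: X) Y + 2 * (D * #|Q|%:R - wt P Q)
    <= D * (#|P :\: X|%:R + #|Y|%:R) ->
  D / 8 * (#|X|%:R + #|Y|%:R - #|P|%:R) <= wt X Y.
Proof.
move=> D0 XP YQ PQ degQ dich.
have eX := wtDl Y XP; have cX := cardsDR XP; have cY := cardsDR YQ.
have [le|lt] := lerP (#|X|%:R + #|Y|%:R) (#|P|%:R : R).
  by apply: le_trans (wt_ge0 _ _); nra.
move: cX eX; set a : R := #|P :\: X|%:R in dich *.
set y : R := #|Y|%:R in cY lt dich *.
move=> cX eX; have y0 : 0 <= y by rewrite ler0n.
have -> : #|X|%:R + y - #|P|%:R = y - a by rewrite cX; ring.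
have {lt} ya : a < y by rewrite cX in lt; lra.
have Dy : 0 <= D * y by rewrite mulr_ge0.
have Dya : 0 <= D * (y - a) by rewrite mulr_ge0 // subr_ge0 ltW.
case: dich => dich.
  have h : 3 / 8 * D * y <= wt Y P.
    by apply: wt_ge => z zY; have /andP[] := degQ z (subsetP YQ _ zY).
  rewrite wtC eX in h; lra.
have h : wt (Q :\: Y) P <= D * #|Q :\: Y|%:R.
  by apply: wt_le => z; rewrite inE => /andP[_ zQ]; have /andP[] := degQ z zQ.
have := wtDr P YQ; rewrite [wt P (Q :\: Y)]wtC eX => eQ.
rewrite eQ cY in dich; lra.
Qed.

(** * Minimal sets of small deficit and the cut condition *)

Section Core.
Variables (D n kap : R) (W0 : {set V}).
Let eta := kap ^+ 2 / 200.
Hypotheses (D_gt0 : 0 < D) (kap01 : 0 < kap <= 1) (kapn : 2 <= kap * n).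
Hypotheses (W0n0 : W0 != set0) (W0n : #|W0|%:R <= n).
Hypothesis deg_W0 : forall u, u \in W0 -> (1 - eta) * D <= wt [set u] W0 <= D.
Hypothesis sparse : forall S, S \subset W0 -> #|S|%:R <= kap * n ->
  wt S S <= D / 4 * #|S|%:R.

(** The total amount by which the degrees inside [S] fall short of [D]. *)
Definition deficit S := D * #|S|%:R - wt S S.

(* The threshold on the deficit is inversely proportional to the size, so that
   a set of half the size beats a minimal one unless its deficit is at least
   twice as large. *)
Lemma minimal_core : exists W, [/\ W \subset W0, kap * n < #|W|%:R,
  deficit W * #|W|%:R <= eta * D * n ^+ 2 &
  forall S, S \proper W -> kap * n <= 2 * #|S|%:R ->
    deficit W * #|W|%:R < deficit S * #|S|%:R].
Proof.
have [k0 k1] := andP kap01.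
have n0 : 0 < n by rewrite -(pmulr_rgt0 _ k0) (lt_le_trans _ kapn).
have eta01 : 0 < eta <= 1 / 200.
  have : kap ^+ 2 <= 1 by rewrite expr_le1 // ltW.
  have : 0 < kap ^+ 2 by rewrite exprn_gt0.
  rewrite /eta; lra.
have W0gt0 : 0 < #|W0|%:R :> R by rewrite ltr0n card_gt0.
have wtW0 : (1 - eta) * D * #|W0|%:R <= wt W0 W0.
  by apply: wt_ge => u /deg_W0/andP[].
have kW0 : kap * n < #|W0|%:R.
  rewrite ltNge; apply/negP => /(sparse (subxx _)).
  have := mulr_gt0 D_gt0 W0gt0; nra.
pose ok S := [&& S \subset W0, kap * n <= 2 * #|S|%:R &
  deficit S * #|S|%:R <= eta * D * n ^+ 2].
have okW0 : ok W0.
  rewrite /ok subxx /=; apply/andP; split; first lra.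
  have : deficit W0 <= eta * D * #|W0|%:R by rewrite /deficit; lra.
  move=> h; apply: (@le_trans _ _ (eta * D * #|W0|%:R * #|W0|%:R)).
    by rewrite ler_pM2r.
  rewrite -mulrA -expr2 ler_pM2l; last by rewrite mulr_gt0 //; lra.
  by rewrite lerXn2r // nnegrE ltW.
case: (@arg_minnP _ W0 ok (fun S => #|S|) okW0) => W /and3P[WW0 kW dW] minW.
(* A smaller [W] would be sparse, with deficit at least [3 / 4 * D * #|W|]. As
   [kap * n <= 2 * #|W|], this exceeds the threshold set by [eta]. *)
have W_gt : kap * n < #|W|%:R.
  rewrite ltNge; apply/negP => le; have := sparse WW0 le; move: dW.
  rewrite /deficit /eta; set v : R := #|W|%:R in kW le * => dW wW.
  have h1 : 3 / 4 * D * v ^+ 2 <= kap ^+ 2 / 200 * D * n ^+ 2.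
    have v0 : 0 <= v by rewrite ler0n.
    apply: le_trans dW; rewrite expr2; nra.
  have h2 : (kap * n) ^+ 2 <= (2 * v) ^+ 2 by rewrite lerXn2r // nnegrE; lra.
  have h3 : 0 < (kap * n) ^+ 2 * D by rewrite mulr_gt0 // exprn_gt0 // mulr_gt0.
  have := ler_wpM2r (ltW D_gt0) h2; rewrite !exprMn in h3 *; nra.
exists W; split => // S SW kS; apply: le_lt_trans dW _.
rewrite ltNge; apply/negP => le.
have := minW S; rewrite /ok le kS (subset_trans (proper_sub SW) WW0).
by move=> /(_ isT); rewrite leqNgt proper_card.
Qed.

Hypothesis concentration : 2 * #|V|%:R * expR (- ((1 / 64) ^+ 2 * D / 8)) < 1.

Definition bipartite A := forall x y, (x \in A) = (y \in A) -> w x y = 0.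

Lemma bipartiteC A : bipartite A -> bipartite (~: A).
Proof. by move=> H x y; rewrite !inE => /negb_inj/H. Qed.

Lemma wt_bipartite0 A X Y : bipartite A -> X \subset A -> Y \subset A -> wt X Y = 0.
Proof.
move=> bA /subsetP XA /subsetP YA; rewrite /wt big1 // => x xX.
by rewrite big1 // => y yY; rewrite bA // XA // YA.
Qed.

(** The sides of the minimal core differ by some [k], which the small deficit bounds. The [k]
    vertices to delete are taken inside a random part of the larger side, so that no vertex opposite
    loses more than [D / 8]. *)
Lemma balanced_core A : bipartite A ->
  exists P Q, [/\ P \subset W0 :&: A, Q \subset W0 :\: A, #|P| = #|Q|,
    kap * n <= 2 * (#|P| + #|Q|)%:R &
    forall X Y, X \subset P -> Y \subset Q ->
      D / 8 * (#|X|%:R + #|Y|%:R - #|P|%:R) <= wt X Y].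
Proof.
move=> bipA; have [W [WW0 W_gt dW minW]] := minimal_core.
have [k0 k1] := andP kap01.
have n0 : 0 < n by rewrite -(pmulr_rgt0 _ k0) (lt_le_trans _ kapn).
have v_gt0 : 0 < #|W|%:R :> R := lt_trans (mulr_gt0 k0 n0) W_gt.
have degD u X : u \in W -> X \subset W -> wt [set u] X <= D.
  move=> uW XW; have /andP[_] := deg_W0 (subsetP WW0 _ uW); apply: le_trans.
  by rewrite wtS // (subset_trans XW).
have def_ge0 S : S \subset W -> 0 <= deficit S.
  move=> SW; rewrite subr_ge0; apply: wt_le => u uS; apply: degD => //.
  exact: (subsetP SW).
(* Deleting a vertex of degree at most [D / 2] would not raise the deficit, against minimality. *)
have deg_gt u : u \in W -> D / 2 < wt [set u] W.
  move=> uW; have uW1 : [set u] \subset W by rewrite sub1set.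
  have cW := cardsDR uW1; rewrite cards1 in cW.
  have kW1 : kap * n <= 2 * #|W :\ u|%:R.
    have := kapn; move: cW W_gt; lra.
  have := minW (W :\ u) (properD1 uW) kW1.
  have := def_ge0 (W :\ u) (subsetDl _ _).
  have wuu : wt [set u] [set u] = 0 by rewrite wt1 big_set1 bipA.
  have := wtDD uW1; have := wtDr [set u] uW1; rewrite wuu.
  rewrite /deficit => -> -> def0 lt.
  rewrite ltNge; apply/negP => le.
  move: lt; apply/negP; rewrite -leNgt; rewrite cW in le def0 *.
  set v' : R := #|_|%:R in le def0 *; have v'0 : 0 <= v' by rewrite ler0n.
  set x := wt _ _ in le def0 *; set y := wt _ _ in le def0 *.
  by nra.
(* A set of at most half the size is small, hence sparse, or by minimality has more than twice the
   deficit of [W]. *)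
have dich U : U \subset W -> 2 * #|U|%:R <= #|W|%:R :> R ->
   wt U U <= D / 4 * #|U|%:R \/ wt U U + 2 * deficit W <= D * #|U|%:R.
  move=> UW U2; have [le|lt] := lerP #|U|%:R (kap * n).
    by left; apply: sparse => //; apply: subset_trans WW0.
  right; have U0 : 0 < #|U|%:R :> R := lt_trans (mulr_gt0 k0 n0) lt.
  have prU : U \proper W.
    rewrite properEneq UW andbT; apply/eqP => UeW; rewrite UeW in U2; lra.
  have kU : kap * n <= 2 * #|U|%:R by move: lt U0; lra.
  have := minW U prU kU.
  have := ler_wpM2l (def_ge0 W (subxx _)) U2.
  rewrite mulrA => h1 /(le_lt_trans h1); rewrite ltr_pM2r // /deficit; lra.
suff main A' : bipartite A' -> (#|W :\: A'| <= #|W :&: A'|)%N ->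
   exists P Q, [/\ P \subset W0 :&: A', Q \subset W0 :\: A', #|P| = #|Q|,
    kap * n <= 2 * (#|P| + #|Q|)%:R &
    forall X Y, X \subset P -> Y \subset Q ->
      D / 8 * (#|X|%:R + #|Y|%:R - #|P|%:R) <= wt X Y].
  case: (leqP #|W :\: A| #|W :&: A|) => [|/ltnW le]; first exact: main.
  have [||P [Q [PA QA PQ sz H]]] := main (~: A).
  - exact: bipartiteC.
  - by rewrite -setDE setDE setCK.
  exists Q, P; rewrite setDE setCK in QA; rewrite -setDE in PA.
  split=> //; first by rewrite addnC.
  move=> X Y XQ YP; have := H Y X YP XQ; rewrite PQ wtC.
  by rewrite [#|Y|%:R + _]addrC.
clear A bipA; move: A' => A bipA le.
pose S := W :&: A; pose T := W :\: A.
have SW : S \subset W by apply: subsetIl.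
have TW : T \subset W by apply: subsetDl.
have SA : S \subset A by apply: subsetIr.
have TA : T \subset ~: A by rewrite /T setDE subsetIr.
have DS : W :\: S = T by rewrite /S setDIr setDv set0U.
have cW : #|W|%:R = #|S|%:R + #|T|%:R :> R by rewrite (cardsDR SW) DS.
have wtWW : wt W W = 2 * wt S T.
  rewrite (wtDD SW) DS (wt_bipartite0 bipA SA SA).
  by rewrite (wt_bipartite0 (bipartiteC bipA) TA TA); ring.
have degS s : s \in S -> wt [set s] W = wt [set s] T.
  move=> sS; rewrite (wtDr _ SW) DS (wt_bipartite0 bipA _ SA) ?add0r //.
  by rewrite sub1set (subsetP SA).
have degT t : t \in T -> wt [set t] W = wt [set t] S.
  move=> tT; rewrite (wtDr _ SW) DS.
  rewrite (wt_bipartite0 (bipartiteC bipA) _ TA) ?addr0 //.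
  by rewrite sub1set (subsetP TA).
pose k := (#|S| - #|T|)%N.
have cS : #|S|%:R = #|T|%:R + k%:R :> R by rewrite -natrD subnKC.
have wST : wt S T <= D * #|T|%:R.
  by rewrite wtC; apply: wt_le => t tT; apply: degD => //; apply: (subsetP TW).
(* All edges inside [W] meet [T], where degrees are at most [D], so each of the [k] surplus vertices
   costs [D]. *)
have defW : D * k%:R <= deficit W by rewrite /deficit wtWW cW cS; lra.
have k_small : k%:R * 200 <= kap * n.
  have h1 : D * k%:R * (kap * n) <= kap ^+ 2 / 200 * D * n ^+ 2.
    apply: le_trans dW; apply: ler_pM => //; last exact: ltW.
      by rewrite mulr_ge0 ?ler0n // ltW.
    by rewrite mulr_ge0 // ltW.
  have kn0 : 0 < kap * n by rewrite mulr_gt0.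
  rewrite -(ler_pM2r kn0) -(ler_pM2l D_gt0); lra.
have T_big : 64 * k%:R <= #|T|%:R :> R by lra.
(* Degrees from [T] lie between [D / 2] and [D], so a sample at rate [1 / 16] receives between
   [D / 64] and [D / 8] from each vertex. The lower bound ensures that it has [k] vertices. *)
have [Z0 Z0P] : exists Z : {set V}, forall t, t \in T ->
    `|wt [set t] (S :&: Z) - wt [set t] S / 16| <= D / 64.
  have e01 : 0 < (1 / 64 : R) <= 1 by lra.
  have p01 : forall v : V, 0 <= (1 / 16 : R) <= 1 by move=> _; lra.
  pose f t s := if (t \in T) && (s \in S) then w t s else 0.
  have sumf (t : V) X : t \in T -> \sum_(s in X) f t s = wt [set t] (S :&: X).
    move=> tT; rewrite wt1 (big_setID S) /= [X in _ + X]big1 ?addr0.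
      rewrite setIC; apply: eq_bigr => s; rewrite inE => /andP[sS _].
      by rewrite /f tT sS.
    by move=> s; rewrite inE /f => /andP[/negbTE-> _]; rewrite andbF.
  have sumT t : t \in T -> \sum_s f t s = wt [set t] S.
    by move=> tT; rewrite -[S in RHS]setIT -sumf //; apply: eq_bigl => s; rewrite inE.
  have [||||Z HZ] := @sampling R V (fun=> 1 / 16) p01 V f D (1 / 64).
  - by move=> t s; rewrite /f; case: ifP => // _; rewrite lexx ler01.
  - move=> t; have [tT|tT] := boolP (t \in T).
      by rewrite sumT //; apply: degD => //; apply: (subsetP TW).
    by rewrite big1 ?ltW // => s _; rewrite /f (negbTE tT).
  - exact: e01.
  - exact: concentration.
  exists Z => t tT; have := HZ t.
  by rewrite sumf // -mulr_sumr sumT // !ler_norml; clear p01; lra.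
have Z0T t : t \in T -> D / 64 <= wt [set t] (S :&: Z0) <= D / 8.
  move=> tT; have := Z0P t tT; rewrite ler_norml.
  have := deg_gt t (subsetP TW _ tT); have := degD t W (subsetP TW _ tT) (subxx _).
  rewrite degT //; lra.
have kZ0 : (k <= #|S :&: Z0|)%N.
  have h1 : D / 64 * #|T|%:R <= wt T (S :&: Z0).
    by apply: wt_ge => t /Z0T/andP[].
  have h2 : wt (S :&: Z0) T <= D * #|S :&: Z0|%:R.
    apply: wt_le => s; rewrite inE => /andP[sS _].
    by apply: degD => //; apply: (subsetP SW).
  rewrite wtC in h2; rewrite -(ler_nat R) -(ler_pM2l D_gt0).
  have := ler_wpM2l (ltW D_gt0) T_big; lra.
have [Z ZSZ cZ] := exists_subset_card kZ0.
have ZS : Z \subset S := subset_trans ZSZ (subsetIl _ _).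
have PT : #|S :\: Z| = #|T| by rewrite cardsD (setIidPr ZS) cZ /k subKn.
have wPT : wt (S :\: Z) T = wt S T - wt Z T by rewrite (wtDl _ ZS); ring.
have wZT : wt Z T <= D * k%:R.
  rewrite -cZ; apply: wt_le => z zZ; apply: degD => //.
  exact: (subsetP (subset_trans ZS SW)).
(* The deletion costs at most [D * k], itself at most [deficit W]; the factor 2 gained from
   minimality pays for it. *)
have defPT : 2 * (D * #|T|%:R - wt (S :\: Z) T) <= 2 * deficit W.
  by move: defW; rewrite wPT /deficit wtWW cW cS; lra.
have PA : S :\: Z \subset A by rewrite (subset_trans (subsetDl _ _)).
exists (S :\: Z), T; split => //.
- by rewrite subsetI PA (subset_trans (subsetDl _ _)) // (subset_trans SW).
- by rewrite setSD.
- rewrite PT natrD; lra.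
move=> X Y XP YT.
have cX := cardsDR XP; have cY := cardsDR YT; rewrite PT in cX.
have disj X' Y' : X' \subset S :\: Z -> Y' \subset T -> X' \subset ~: Y'.
  move=> XP' YT'; rewrite -setCS setCK (subset_trans YT') //.
  by rewrite (subset_trans TA) // setCS (subset_trans XP').
have wtU X' Y' : X' \subset S :\: Z -> Y' \subset T ->
    wt (X' :|: Y') (X' :|: Y') = 2 * wt X' Y'.
  move=> XP' YT'; rewrite wtUU ?disj //.
  rewrite (wt_bipartite0 bipA) ?(subset_trans XP') //.
  by rewrite (wt_bipartite0 (bipartiteC bipA) (X := Y')) ?(subset_trans YT') //; ring.
have cU X' Y' : X' \subset S :\: Z -> Y' \subset T ->
    #|X' :|: Y'|%:R = #|X'|%:R + #|Y'|%:R :> R.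
  move=> XP' YT'; rewrite cardsU natrB ?natrD; last first.
    by rewrite (leq_trans (subset_leq_card (subsetIl _ _))) ?leq_addr.
  suff -> : X' :&: Y' = set0 by rewrite cards0 subr0.
  by apply/eqP; rewrite setI_eq0 disjoints_subset disj.
have subW X' Y' : X' \subset S :\: Z -> Y' \subset T -> X' :|: Y' \subset W.
  move=> XP' YT'; rewrite subUset (subset_trans YT') // (subset_trans XP') //.
  by rewrite (subset_trans (subsetDl _ _)).
have dich' X' Y' : X' \subset S :\: Z -> Y' \subset T ->
   #|X'|%:R + #|Y'|%:R <= #|T|%:R :> R ->
   2 * wt X' Y' <= D / 4 * (#|X'|%:R + #|Y'|%:R) \/
   2 * wt X' Y' + 2 * (D * #|T|%:R - wt (S :\: Z) T)
     <= D * (#|X'|%:R + #|Y'|%:R).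
  move=> XP' YT' small; rewrite -wtU // -cU //.
  have [||h|h] := dich (X' :|: Y'); rewrite ?subW //; last by right; lra.
    rewrite cU // cW cS; have : 0 <= k%:R :> R by rewrite ler0n.
    lra.
  by left.
have Dge0 := ltW D_gt0.
(* With [P] for [S :\: Z], the unions of [P :\: X] with [Y] and of [X] with [T :\: Y] have
   [2 * #|T|] vertices together, so one of them has at most [#|T|]; the second case exchanges the
   sides. *)
have [leXY|ltXY] := lerP (#|S :\: Z :\: X|%:R + #|Y|%:R) (#|T|%:R : R).
  apply: (@half_ore D (S :\: Z) T X Y) => //.
    move=> t tT; apply/andP; split; last first.
      by apply: degD; [apply: (subsetP TW) | rewrite (subset_trans (subsetDl _ _))].
    have := wtDr [set t] ZS; rewrite -degT //.
    have := deg_gt t (subsetP TW _ tT).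
    have /andP[_] := Z0T t tT; have := wtS (subxx [set t]) ZSZ; lra.
  by apply: dich' => //; rewrite (subset_trans (subsetDl _ _)).
rewrite wtC PT -PT [#|X|%:R + _]addrC PT.
apply: (@half_ore D T (S :\: Z) Y X) => //.
  move=> s sP; have sS : s \in S by move: sP; rewrite inE => /andP[].
  rewrite -degS // degD ?(subsetP SW) // andbT.
  by have := deg_gt s (subsetP SW _ sS); lra.
rewrite PT [wt T _]wtC [wt (T :\: Y) _]wtC [#|T :\: Y|%:R + _]addrC.
apply: dich' => //; first by rewrite subsetDl.
by lra.
Qed.
End Core.
End WeightedGraph.

(** * From almost regular to nearly regular *)

(** Deleting an element of at most average weight does not lower the average; this is repeated until
    [h] elements remain. *)
Lemma exists_heavy_subset (R : realFieldType) (T : finType) (f : T -> R)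
    (A : {set T}) (h : nat) : (forall x, 0 <= f x) -> (h <= #|A|)%N ->
  exists B : {set T}, [/\ B \subset A, #|B| = h &
    h%:R * \sum_(x in A) f x <= #|A|%:R * \sum_(x in B) f x].
Proof.
move=> f0; move: {2}(#|A| - h)%N (erefl (#|A| - h)%N) => m.
elim: m A => [|m IH] A Am hA.
  by exists A; split => //; [lia | have -> : h = #|A| by lia].
have [u uA fu] : exists2 u, u \in A & #|A|%:R * f u <= \sum_(x in A) f x.
  case: (pickP (fun u => (u \in A) && (#|A|%:R * f u <= \sum_(x in A) f x))).
    by move=> u /andP[? ?]; exists u.
  move=> none; have [u0 u0A] : exists u, u \in A.
    by apply/set0Pn; rewrite -card_gt0; lia.
  have : \sum_(x in A) (\sum_(y in A) f y) < \sum_(x in A) #|A|%:R * f x.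
    apply: ltr_sum => [|x xA]; first by apply/hasP; exists u0; rewrite ?mem_index_enum.
    by have := none x; rewrite xA /= => /negbT; rewrite -ltNge.
  by rewrite sumr_const -mulr_sumr mulr_natl ltxx.
have cA : #|A| = #|A :\ u|.+1 by rewrite (cardsD1 u A) uA.
have [B [BA cB hB]] := IH (A :\ u) ltac:(lia) ltac:(lia).
exists B; split => //; first exact: subset_trans BA (subsetDl _ _).
have sA : \sum_(x in A) f x = f u + \sum_(x in A :\ u) f x by rewrite (big_setD1 u).
have [c0|c0] := posnP #|A :\ u|.
  have -> : h = 0%N by lia.
  by rewrite mul0r mulr_ge0 ?ler0n // sumr_ge0.
have c0R : 0 < #|A :\ u|%:R :> R by rewrite ltr0n.
have h0 : 0 <= h%:R :> R by rewrite ler0n.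
rewrite -(ler_pM2l c0R).
move: fu hB; rewrite sA cA -natr1.
set c : R := #|A :\ u|%:R in c0R *; set a := \sum_(x in A :\ u) f x.
set b := \sum_(x in B) f x; move: (f u) (h%:R : R) h0 => y z z0 h1 h2.
have h3 : (c + 1) * (z * a) <= (c + 1) * (c * b) by rewrite ler_wpM2l //; lra.
have h4 : z * (c * y) <= z * a by rewrite ler_wpM2l //; lra.
lra.
Qed.

Section AlmostRegular.
Variables (R : realType) (V : finType) (g : V -> V -> R).
Hypothesis g_sym : forall x y, g x y = g y x.
Hypothesis g01 : forall x y, 0 <= g x y <= 1.

Lemma almost_regular_subset (W : {set V}) (d K : R) : 0 < d -> 0 < K -> W != set0 ->
  wt g W W = d * #|W|%:R ->
  (forall S : {set V}, S \subset W -> K * #|S|%:R <= 2 * #|W|%:R ->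
     wt g S S <= d / 16 * #|S|%:R) ->
  exists S : {set V}, [/\ S \subset W, S != set0 &
    forall u, u \in S -> d / 4 <= wt g [set u] S <= K * d].
Proof.
move=> d0 K0 Wn0 wW sparse.
have n0 : 0 < #|W|%:R :> R by rewrite ltr0n card_gt0.
pose X := [set u in W | K * d < wt g [set u] W].
have XW : X \subset W by apply/subsetP => u; rewrite inE => /andP[].
have KX : K * #|X|%:R <= #|W|%:R.
  have : K * d * #|X|%:R <= wt g X W.
    by apply: wt_ge => u; rewrite inE => /andP[_ /ltW].
  have := wtS g_sym g01 XW (subxx W); rewrite wW => h1 h2.
  rewrite -(ler_pM2l d0); lra.
have wX : wt g X W <= d * #|W|%:R / 8.
  have [X0|Xn0] := eqVneq X set0.
    by rewrite X0 /wt big_set0 divr_ge0 ?mulr_ge0 ?ler0n ?(ltW d0).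
  have x0 : 0 < #|X|%:R :> R by rewrite ltr0n card_gt0.
  have fge0 y : 0 <= wt g [set y] X by apply: wt_ge0.
  (* [T] has the size of [X] and at least its proportional share of the weight between [W] and [X];
     the share is bounded because [X :|: T] is small, hence sparse. *)
  have [T [TW cT hT]] := exists_heavy_subset fge0 (subset_leq_card XW).
  rewrite -!wt_suml in hT; rewrite (wtC g_sym).
  rewrite -(ler_pM2l x0); apply: le_trans hT _.
  have h1 : wt g T X <= wt g (X :|: T) (X :|: T).
    by apply: wtS => //; rewrite ?subsetUl ?subsetUr.
  have c2 : #|X :|: T|%:R <= 2 * #|X|%:R :> R.
    rewrite -natrM ler_nat mul2n -addnn cardsU cT; exact: leq_subr.
  have := sparse (X :|: T); rewrite subUset XW TW => /(_ isT _)/wrap[].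
    by apply: le_trans (ler_wpM2l (ltW K0) c2) _; lra.
  move=> h2; have := ler_wpM2l (ltW n0) (le_trans h1 h2).
  have := ler_wpM2l (ltW (mulr_gt0 n0 d0)) c2; lra.
(* A maximiser is nonempty because [val (W :\: X)] is positive, and deleting a vertex of degree
   below [d / 4] would increase [val]. *)
pose val (S : {set V}) := wt g S S - d / 2 * #|S|%:R.
have wR : 0 < val (W :\: X).
  rewrite /val; have -> : #|W :\: X|%:R = #|W|%:R - #|X|%:R :> R.
    by rewrite (cardsDR R XW); ring.
  have := wtDD g_sym XW.
  have := wtDr g_sym X XW; have := wt_ge0 g01 X X; rewrite wW.
  have : 0 <= d * #|X|%:R by rewrite mulr_ge0 // ltW.
  have := mulr_gt0 d0 n0; lra.
case: (@arg_maxP _ _ _ (W :\: X) (fun S : {set V} => S \subset W :\: X) val (subxx _)).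
move=> S SR maxS; exists S; split.
- by rewrite (subset_trans SR) ?subsetDl.
- apply/eqP => S0; have := maxS _ (subxx (W :\: X)); rewrite S0 /= => h.
  by have := lt_le_trans wR h; rewrite /val /wt big_set0 cards0 mulr0 subrr ltxx.
move=> u uS; have u1 : [set u] \subset S by rewrite sub1set.
apply/andP; split; last first.
  have := subsetP SR u uS; rewrite !inE => /andP[+ uW].
  rewrite uW /= -leNgt; apply: le_trans; apply: wtS => //.
  by rewrite (subset_trans SR) ?subsetDl.
have := maxS (S :\ u); rewrite (subset_trans (subsetDl _ _) SR) => /(_ isT) /=.
rewrite /val (cardsDR R u1) cards1 (wtDD g_sym u1) (wtDr g_sym [set u] u1).
have := wt_ge0 g01 [set u] [set u]; lra.
Qed.

(* Sampling each vertex with probability proportional to its degree and giving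
   the edge xy a weight inversely proportional to deg x * deg y makes all
   expected weighted degrees equal. *)
Lemma near_regular_weights (S : {set V}) (d K zeta : R) :
  0 < d -> 0 < K -> S != set0 -> 0 < zeta < 1 ->
  (forall u, u \in S -> d / 4 <= wt g [set u] S <= K * d) ->
  2 * #|V|%:R * expR (- ((zeta / (16 * K ^+ 2)) ^+ 2 * (K * d) / 8)) < 1 ->
  exists (w : V -> V -> R) (W0 : {set V}), [/\ forall x y, w x y = w y x,
    forall x y, 0 <= w x y <= g x y, W0 \subset S, W0 != set0 &
    forall u, u \in W0 ->
      (1 - zeta) * (d / (16 * K)) <= wt w [set u] W0 <= (1 + zeta) * (d / (16 * K))].
Proof.
move=> d0 K0 Sn0 /andP[z0 z1] degS small.
have Kd0 : 0 < K * d by apply: mulr_gt0.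
have [s sS] := set0Pn _ Sn0.
have K4 : 1 <= 4 * K.
  have /andP[h1 h2] := degS s sS; rewrite -(ler_pM2r d0); lra.
have K16 : 1 <= 16 * K ^+ 2.
  have -> : 16 * K ^+ 2 = (4 * K) ^+ 2 by ring.
  by rewrite expr_ge1 //; lra.
pose p v := if v \in S then wt g [set v] S / (K * d) else 0.
have pS v : v \in S -> (4 * K)^-1 <= p v <= 1.
  move=> vS; have /andP[h1 h2] := degS v vS; rewrite /p vS.
  rewrite ler_pdivrMr // mul1r h2 andbT ler_pdivlMr //.
  suff -> : (4 * K)^-1 * (K * d) = d / 4 by [].
  by field; lra.
have p01 v : 0 <= p v <= 1.
  have [vS|vS] := boolP (v \in S).
    by have /andP[h ->] := pS v vS; rewrite andbT (le_trans _ h) // invr_ge0; lra.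
  by rewrite /p (negbTE vS) lexx ler01.
have p_gt0 v : v \in S -> 0 < p v.
  by move=> /pS/andP[h _]; apply: lt_le_trans h; rewrite invr_gt0; lra.
(* Since [p] is at least [(4 * K)^-1] on [S], this factor ensures [w <= g]. *)
pose th := (16 * K ^+ 2)^-1.
have th0 : 0 < th by rewrite invr_gt0; lra.
pose w x y := if (x \in S) && (y \in S) then th * g x y / (p x * p y) else 0.
have w_sym x y : w x y = w y x.
  by rewrite /w andbC g_sym [p x * _]mulrC.
have wg x y : 0 <= w x y <= g x y.
  have /andP[gx0 _] := g01 x y; rewrite /w.
  case: ifP => [/andP[xS yS]|_]; last by rewrite lexx gx0.
  have px := p_gt0 x xS; have py := p_gt0 y yS.
  have pp := mulr_gt0 px py.
  apply/andP; split; first by rewrite divr_ge0 ?(ltW pp) ?mulr_ge0 ?(ltW th0).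
  rewrite ler_pdivrMr // mulrC ler_wpM2l //.
  have -> : th = (4 * K)^-1 * (4 * K)^-1 by rewrite /th; field; lra.
  have /andP[hx _] := pS x xS; have /andP[hy _] := pS y yS.
  by apply: ler_pM => //; rewrite invr_ge0; lra.
have w01 x y : 0 <= w x y <= 1.
  have /andP[-> h] := wg x y; have /andP[_] := g01 x y; exact: le_trans.
have wsum j (Z : {set V}) : \sum_(v in Z) w j v = wt w [set j] (S :&: Z).
  rewrite wt1 (big_setID S) /= [X in _ + X]big1 ?addr0; last first.
    by move=> v; rewrite inE /w => /andP[/negbTE-> _]; rewrite andbF.
  by rewrite setIC.
have [||||Z HZ] := @sampling R V p p01 V w (K * d) (zeta / (16 * K ^+ 2)).
- exact: w01.
- move=> j; have [jS|jS] := boolP (j \in S); last first.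
    by rewrite big1 ?ltW // => v _; rewrite /w (negbTE jS).
  have /andP[_] := degS j jS; apply: le_trans; rewrite wt1 [leRHS]big_mkcond /=.
  apply: ler_sum => v _; case: ifP => vS; first by have /andP[] := wg j v.
  by rewrite /w vS andbF.
- rewrite divr_gt0 //=; last lra.
  by rewrite ler_pdivrMr; lra.
- exact: small.
have degZ j : j \in S ->
    (1 - zeta) * (d / (16 * K)) <= wt w [set j] (S :&: Z) <= (1 + zeta) * (d / (16 * K)).
  move=> jS; have := HZ j; rewrite wsum.
  (* The factor [p v] cancels, which leaves [th / p j] times the degree of [j], that is
     [th * (K * d)]. *)
  have -> : \sum_v p v * w j v = d / (16 * K).
    have pj := p_gt0 j jS.
    rewrite (eq_bigr (fun v => if v \in S then th / p j * g j v else 0)); last first.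
      move=> v _; rewrite /w jS /=; case: ifP => vS; last by rewrite mulr0.
      have pv := p_gt0 v vS; by field; rewrite !gt_eqF.
    rewrite -big_mkcond -mulr_sumr -wt1 /p jS /th.
    have /andP[dj _] := degS j jS.
    have dj0 : 0 < wt g [set j] S by lra.
    by field; rewrite !gt_eqF.
  have -> : zeta / (16 * K ^+ 2) * (K * d) = zeta * (d / (16 * K)) by field; rewrite gt_eqF.
  rewrite ler_norml; lra.
exists w, (S :&: Z); split => //; first exact: subsetIl.
  apply/eqP => E; have := degZ s sS; rewrite E => /andP[].
  rewrite {1}wtC // /wt big_set0 leNgt mulr_gt0 ?subr_gt0 //.
  by rewrite divr_gt0 // mulr_gt0.
by move=> u; rewrite inE => /andP[/degZ].
Qed.
End AlmostRegular.

(** * Dense bipartite graphs *)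

Lemma powR_small (R : realType) (s n tau e : R) : 0 <= s -> 0 <= n -> 0 < tau -> 0 < e ->
  s <= tau `^ e^-1 * n -> s `^ e <= tau * n `^ e.
Proof.
move=> s0 n0 t0 e0 sn.
have -> : tau * n `^ e = (tau `^ e^-1 * n) `^ e.
  by rewrite powRM ?powR_ge0 // -powRrM mulVf ?gt_eqF // powRr1 // ltW.
by rewrite ge0_ler_powR ?nnegrE ?mulr_ge0 ?powR_ge0 // ltW.
Qed.

Section DenseCore.
Variables (R : realType) (e : R).
Hypothesis e01 : 0 < e < 1.

(** The bound on [wt g S S] is what maximality of wt W W / |W|^(1+e) provides: sets smaller than a
    fraction t^(1/e) of [W] have average degree at most [t * d]. The constants depend on [e]
    only. *)
Lemma dense_core : exists a kap : R, [/\ 0 < a, 0 < kap &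
  forall (V : finType) (g : V -> V -> R) (A W : {set V}) (d : R),
    (forall x y, g x y = g y x) -> (forall x y, 0 <= g x y <= 1) ->
    bipartite g A -> W != set0 -> 0 < d -> wt g W W = d * #|W|%:R ->
    (forall S : {set V}, S \subset W ->
       wt g S S * #|W|%:R `^ e <= d * #|S|%:R * #|S|%:R `^ e) ->
    2 * #|V|%:R * expR (- (a * d)) < 1 -> 2 <= kap * #|W|%:R ->
    exists P Q : {set V}, [/\ P \subset W :&: A, Q \subset W :\: A, #|P| = #|Q|,
      kap * #|W|%:R <= 2 * (#|P| + #|Q|)%:R &
      forall X Y : {set V}, X \subset P -> Y \subset Q ->
        a * d * (#|X|%:R + #|Y|%:R - #|P|%:R) <= wt g X Y]].
Proof.
have [e0 e1] := andP e01.
pose kap1 : R := (1 / 16) `^ e^-1.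
have kap1_gt0 : 0 < kap1 by rewrite powR_gt0; lra.
pose K := 2 / kap1; have K0 : 0 < K by rewrite divr_gt0.
(* The weighted degrees will be about [d / (16 * K)], and the core needs a quarter of that as its
   sparsity level. *)
pose tau := (64 * K)^-1; have tau0 : 0 < tau by rewrite invr_gt0; lra.
pose kap := tau `^ e^-1.
have kap0 : 0 < kap by rewrite powR_gt0.
have kap1_le1 : kap1 <= 1.
  by rewrite -(powRr0 (1 / 16)) ger_powR ?invr_ge0 ?ltW //; lra.
have K2 : 2 <= K by rewrite /K ler_pdivlMr //; lra.
have kap_le1 : kap <= 1.
  rewrite -(powRr0 tau) ger_powR ?invr_ge0 ?(ltW e0) // tau0 /tau.
  by rewrite invf_le1; lra.
(* Half of the tolerance of the core, because [(1 - 2 * zeta) * (1 + zeta) <= 1 - zeta]. *)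
pose zeta := kap ^+ 2 / 400.
have k2 : 0 < kap ^+ 2 by rewrite exprn_gt0.
have k2' : kap ^+ 2 <= 1 by rewrite expr_le1 // ltW.
have z01 : 0 < zeta < 1 by rewrite /zeta; lra.
have [z0 z1] := andP z01.
pose a1 := (zeta / (16 * K ^+ 2)) ^+ 2 * K / 8.
pose a2 := (1 / 64) ^+ 2 / (16 * K) / 8.
pose a3 := 1 / (128 * K).
(* [a1] and [a2] serve the two sampling steps, [a3] the cut condition. *)
pose a := Num.min a1 (Num.min a2 a3).
have K2gt0 : 0 < K ^+ 2 by rewrite exprn_gt0.
have a0 : 0 < a.
  rewrite !lt_min; apply/and3P; split.
  - have zK : 0 < zeta / (16 * K ^+ 2) by rewrite divr_gt0 // mulr_gt0.
    by rewrite /a1 divr_gt0 // mulr_gt0 // exprn_gt0.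
  - have s0 : 0 < (1 / 64) ^+ 2 :> R by rewrite exprn_gt0 //; lra.
    by rewrite /a2 divr_gt0 // divr_gt0 // mulr_gt0.
  - by rewrite /a3 divr_gt0 // mulr_gt0.
have aa1 : a <= a1 by rewrite ge_min lexx.
have aa2 : a <= a2 by rewrite !ge_min lexx orbT.
have aa3 : a <= a3 by rewrite !ge_min lexx !orbT.
exists a, kap; split => // V g A W d g_sym g01 bipA Wn0 d0 wW sparse conc kW.
have n0 : 0 < #|W|%:R :> R by rewrite ltr0n card_gt0.
have conc_ge b : a * d <= b -> 2 * #|V|%:R * expR (- b) < 1.
  move=> ab; apply: le_lt_trans conc; rewrite ler_wpM2l ?mulr_ge0 //.
  by rewrite ler_expR lerN2.
have sparse_tau t (S : {set V}) : 0 < t -> S \subset W ->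
    #|S|%:R <= t `^ e^-1 * #|W|%:R ->
    wt g S S <= t * d * #|S|%:R.
  move=> t0 SW small; have := powR_small (ler0n _ _) (ltW n0) t0 e0 small.
  have ne0 : 0 < #|W|%:R `^ e :> R by rewrite powR_gt0.
  move=> h; rewrite -(ler_pM2r ne0); apply: le_trans (sparse S SW) _.
  have ds : 0 <= d * #|S|%:R by rewrite mulr_ge0 // ltW.
  have := ler_wpM2l ds h; lra.
have [S [SW Sn0 degS]] : exists S : {set V}, [/\ S \subset W, S != set0 &
    forall u, u \in S -> d / 4 <= wt g [set u] S <= K * d].
  apply: (almost_regular_subset g_sym g01 d0 K0 Wn0 wW) => S SW KS.
  have := @sparse_tau (1 / 16) S; rewrite -/kap1 => /(_ _ SW _)/wrap[|| h].
  - lra.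
  - rewrite -(ler_pM2l K0); apply: le_trans KS _.
    by rewrite /K mulrA divfK ?gt_eqF.
  - lra.
have [|w [W0 [w_sym wg W0S W0n0 degW0]]] :=
    near_regular_weights g_sym g01 d0 K0 Sn0 z01 degS.
  apply: conc_ge; have := ler_wpM2r (ltW d0) aa1; rewrite /a1; lra.
pose D := (1 + zeta) * (d / (16 * K)).
have dK0 : 0 < d / (16 * K) by rewrite divr_gt0 // mulr_gt0.
have D_ge : d / (16 * K) <= D by rewrite /D; nra.
have D0 : 0 < D by apply: lt_le_trans D_ge.
have w01 x y : 0 <= w x y <= 1.
  by have /andP[-> h] := wg x y; have /andP[_] := g01 x y; apply: le_trans.
have wt_wg (X Y : {set V}) : wt w X Y <= wt g X Y.
  by apply: ler_sum => x _; apply: ler_sum => y _; have /andP[] := wg x y.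
have [||||||P [Q [PA QA PQ sz ore]]] :=
    @balanced_core R V w w_sym w01 D #|W|%:R kap W0 D0 _ kW W0n0 _ _ _ _ A.
- by rewrite kap0.
- by rewrite ler_nat subset_leq_card // (subset_trans W0S).
- move=> u /degW0/andP[h1 h2]; rewrite h2 andbT; apply: le_trans h1.
  have -> : kap ^+ 2 / 200 = 2 * zeta by rewrite /zeta; lra.
  rewrite /D [leLHS]mulrA ler_pM2r //; nra.
- move=> U UW small; apply: le_trans (wt_wg U U) _.
  have := @sparse_tau tau U tau0 (subset_trans UW (subset_trans W0S SW)) small.
  move=> /le_trans; apply; rewrite ler_wpM2r //.
  have -> : tau * d = d / (16 * K) / 4 by rewrite /tau; field; rewrite gt_eqF.
  lra.
- apply: conc_ge; apply: le_trans (ler_wpM2r (ltW d0) aa2) _.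
  have -> : a2 * d = (1 / 64) ^+ 2 * (d / (16 * K)) / 8.
    by rewrite /a2; field; rewrite gt_eqF.
  by have := ler_wpM2l (sqr_ge0 (1 / 64 : R)) D_ge; lra.
- by move=> x y xy; have := bipA x y xy; have := wg x y => /[swap] ->; lra.
have W0W := subset_trans W0S SW.
exists P, Q; split => //.
- by rewrite (subset_trans PA) // setSI.
- by rewrite (subset_trans QA) // setSD.
move=> X Y XP YQ; have [le|lt] := lerP (#|X|%:R + #|Y|%:R - #|P|%:R) (0 : R).
  apply: le_trans (wt_ge0 g01 X Y); rewrite mulr_ge0_le0 // mulr_ge0 // ltW //.
apply: le_trans (le_trans (ore X Y XP YQ) (wt_wg X Y)).
rewrite ler_pM2r //; apply: le_trans (ler_wpM2r (ltW d0) aa3) _.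
have -> : a3 * d = d / (16 * K) / 8 by rewrite /a3; field; rewrite gt_eqF.
lra.
Qed.
End DenseCore.

(** * Large cuts *)

Section Cut.
Variables (R : realType) (V : finType) (g : V -> V -> R).
Hypothesis g_sym : forall x y, g x y = g y x.
Hypothesis g_irr : forall x, g x x = 0.

(** In a maximum cut no vertex gains by changing sides, so each sends at least as much weight across
    as to its own side. *)
Lemma exists_large_cut : exists A : {set V},
  wt g setT setT <= 4 * wt g A (~: A).
Proof.
case: (@arg_maxP _ _ _ set0 predT (fun A : {set V} => wt g A (~: A)) isT).
move=> A _ maxA; exists A.
have half B : (forall A', wt g A' (~: A') <= wt g B (~: B)) -> wt g B B <= wt g B (~: B).
  move=> maxB; rewrite (wt_suml g B B) (wt_suml g B (~: B)).
  apply: ler_sum => u uB; have u1 : [set u] \subset B by rewrite sub1set.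
  have := maxB (B :\ u); rewrite (wtDl g (~: B) u1) (wtDr g_sym [set u] u1).
  have guu : wt g [set u] [set u] = 0 by rewrite wt1 big_set1 g_irr.
  rewrite guu add0r.
  have uC : [set u] \subset ~: (B :\ u) by rewrite sub1set !inE eqxx.
  rewrite (wtDr g_sym (B :\ u) uC) (wtC g_sym (B :\ u) [set u]).
  have -> : ~: (B :\ u) :\: [set u] = ~: B.
    apply/setP => x; rewrite !inE; have [->|] := eqVneq x u; rewrite ?uB //=.
  lra.
have h1 := half A (fun A' => maxA A' isT).
have h2 : wt g (~: A) (~: A) <= wt g (~: A) A.
  have := half (~: A); rewrite setCK; apply => A'.
  by rewrite (wtC g_sym (~: A) A); apply: maxA.
rewrite (wtDD g_sym (subsetT A)) setTD; move: h2; rewrite (wtC g_sym (~: A) A); lra.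
Qed.
End Cut.

(** * Regular subgraphs *)

Lemma eventually_powR_ge (R : realType) (C e : R) : 0 < C -> 0 < e ->
  exists n0 : nat, forall n : nat, (n0 <= n)%N -> C <= n%:R `^ e.
Proof.
move=> C0 e0; exists (Num.truncn (C `^ e^-1)).+1 => n hn.
have : C `^ e^-1 <= n%:R.
  by apply: le_trans (ltW (truncnS_gt _)) _; rewrite ler_nat.
move=> h; have -> : C = (C `^ e^-1) `^ e.
  by rewrite -powRrM mulVf ?gt_eqF // powRr1 // ltW.
by rewrite ge0_ler_powR ?nnegrE ?powR_ge0 // ltW.
Qed.

Lemma powRD_gt0 (R : realType) (x r s : R) : 0 < x -> x `^ (r + s) = x `^ r * x `^ s.
Proof. by move=> x0; rewrite powRD // (gt_eqF x0) implybT. Qed.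

(** With y = n^e, the logarithm of [2 * n] is ln 2 + (ln y) / e, which is less than (2 + 1/e) y and
    hence less than b y^2. *)
Lemma natr_mul_expRN_lt1 (R : realType) (n : nat) (b e : R) :
  (0 < n)%N -> 0 < e -> 0 < b -> 1 <= n%:R `^ e -> (2 + e^-1) / b < n%:R `^ e ->
  2 * n%:R * expR (- (b * (n%:R `^ e * n%:R `^ e))) < 1.
Proof.
move=> n0 e0 b0; set y := _ `^ _ => y1 yb.
have nR0 : 0 < n%:R :> R by rewrite ltr0n.
have y0 : 0 < y by lra.
rewrite -(lnK (x := 2 * n%:R)) ?posrE ?mulr_gt0 // -expRD expR_lt1 subr_lt0.
rewrite lnM ?posrE //.
have -> : ln n%:R = e^-1 * ln y by rewrite /y ln_powR mulKf ?gt_eqF.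
have ln2 : ln 2 < 2 :> R by apply: ln_sublinear.
have lny : ln y < y by apply: ln_sublinear.
have ei0 : 0 < e^-1 by rewrite invr_gt0.
have h1 : e^-1 * ln y < e^-1 * y by rewrite ltr_pM2l.
have h2 : 2 + e^-1 < y * b by rewrite -ltr_pdivrMr.
have := ltr_pM2r y0 (2 + e^-1) (y * b); rewrite h2 => h3.
nra.
Qed.

(** * Ordered pairs of vertices and edges of the graph *)

Section GraphArcs.
Variables (T : finType) (G : sgraph T).
Let V := {x : T | x \in vertices G}.
Definition uedge (e : V * V) : {set T} := [set val e.1; val e.2].

Lemma card_arcs_ge : (2 * #|edges G| <= #|[set e | uedge e \in edges G]|)%N.
Proof.
have -> : #|[set e | uedge e \in edges G]| = (\sum_(e | uedge e \in edges G) 1)%N.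
  by rewrite -sum1_card; apply: eq_bigl => e; rewrite inE.
rewrite (partition_big uedge (mem (edges G))) //= mulnC -sum_nat_const.
apply: leq_sum => B BE; have {}BE : B \in edges G := BE.
have [BG /eqP/cards2P[a [b [ab eB]]]] := edgesP BE.
have aG : a \in vertices G by apply: (subsetP BG); rewrite eB !inE eqxx.
have bG : b \in vertices G by apply: (subsetP BG); rewrite eB !inE eqxx orbT.
rewrite sum1_card; apply/card_gt1P.
pose x : V := Sub a aG; pose z : V := Sub b bG.
have xz : uedge (x, z) = B by rewrite eB.
have zx : uedge (z, x) = B by rewrite eB setUC.
exists (x, z), (z, x); split.
- by rewrite unfold_in /= xz BE eqxx.
- by rewrite unfold_in /= zx BE eqxx.
by apply: contra ab => /eqP[->].
Qed.

(** All arcs go from [P] to the disjoint set [Q], so forgetting directions is injective on [F] and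
    preserves degrees. *)
Lemma regular_subgraph_of_arcs (P Q : {set V}) (F : {set V * V}) (r : nat) :
  Q \subset ~: P -> #|P| = #|Q| -> (forall e, e \in F -> uedge e \in edges G) ->
  (forall e, e \in F -> (e.1 \in P) && (e.2 \in Q)) ->
  (forall a, a \in P -> arcs F [set a] Q = r) ->
  (forall b, b \in Q -> arcs F P [set b] = r) ->
  exists H : sgraph T, [/\ subgraph H G, regular H,
    #|vertices H| = (#|P| + #|Q|)%N & #|edges H| = (r * #|P|)%N].
Proof.
move=> /subsetP QP PQ FE FPQ degP degQ.
have ne a b : a \in P -> b \in Q -> (a == b) = false.
  by move=> aP /QP; rewrite inE; case: eqP => // <-; rewrite aP.
have val_in e a : (val a \in uedge e) = (a == e.1) || (a == e.2).
  by rewrite !inE.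
have inj : {in F &, injective uedge}.
  move=> e e' eF e'F eq; have /andP[e1 e2] := FPQ e eF; have /andP[e1' e2'] := FPQ e' e'F.
  have := val_in e' e.1; rewrite -eq val_in eqxx (ne _ e'.2) // orbF => /esym/eqP h1.
  have := val_in e' e.2; rewrite -eq val_in eqxx orbT eq_sym (ne e'.1) // => /esym/eqP h2.
  by rewrite [e]surjective_pairing h1 h2 -surjective_pairing.
have HP A : A \in uedge @: F -> A \subset val @: (P :|: Q) /\ #|A| = 2%N.
  move=> /imsetP[e eF ->]; have /andP[e1 e2] := FPQ e eF; split.
    by apply/subsetP => x; rewrite !inE => /orP[]/eqP->;
      apply: imset_f; rewrite inE ?e1 ?e2 ?orbT.
  by rewrite cards2 (inj_eq val_inj) ne.
pose H := SGraph HP.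
have degH v : v \in P :|: Q -> degree H (val v) = r.
  move=> vPQ; rewrite /degree.
  have -> : [set A in edges H | val v \in A] = uedge @: [set e in F | val v \in uedge e].
    apply/setP => A; rewrite inE; apply/andP/imsetP.
      by move=> [/imsetP[e eF ->] ve]; exists e; rewrite // inE eF.
    by move=> [e]; rewrite inE => /andP[eF ve] ->; rewrite imset_f.
  rewrite card_in_imset; last first.
    by move=> e e'; rewrite !inE => /andP[eF _] /andP[e'F _]; apply: inj.
  rewrite -sum1_card big_mkcond /=; move: vPQ; rewrite inE => /orP[vP|vQ].
    rewrite -(degP v vP) /arcs [RHS]big_mkcond; apply: eq_bigr => e _.
    rewrite !inE; case: (boolP (e \in F)) => //= eF; have /andP[_ e2] := FPQ e eF.
    by rewrite !(inj_eq val_inj) (ne v e.2) // orbF e2 andbT eq_sym; case: eqP.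
  rewrite -(degQ v vQ) /arcs [RHS]big_mkcond; apply: eq_bigr => e _.
  rewrite !inE; case: (boolP (e \in F)) => //= eF; have /andP[e1 _] := FPQ e eF.
  by rewrite !(inj_eq val_inj) [v == e.1]eq_sym (ne e.1 v) // e1 /= eq_sym; case: eqP.
exists H; split.
- split; first by apply/subsetP => x /imsetP[y _ ->]; apply: (valP y).
  by apply/subsetP => A /imsetP[e eF ->]; apply: FE.
- by move=> u v /imsetP[u' u'P ->] /imsetP[v' v'P ->]; rewrite !degH.
- rewrite card_imset; last exact: val_inj.
  rewrite cardsU; suff -> : P :&: Q = set0 by rewrite cards0 subn0.
  apply/setP => x; rewrite !inE; apply/andP => -[xP xQ].
  by have := ne x x xP xQ; rewrite eqxx.
rewrite card_in_imset // mulnC -sum_nat_const -(eq_bigr _ degP) -arcs_suml.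
by rewrite /arcs -sum1_card; apply: eq_bigr => e /FPQ ->.
Qed.
End GraphArcs.

(** Returns from weights to a plain arc set, to which the factor theorem applies. *)
Lemma wt_le_arcs (R : realType) (V : finType) (g : V -> V -> R) (X Y : {set V}) :
  (forall x y, 0 <= g x y <= 1) ->
  wt g X Y <= (arcs [set e | g e.1 e.2 != 0] X Y)%:R.
Proof.
move=> g01; rewrite /wt pair_big /arcs natr_sum [leRHS]big_mkcond [leLHS]big_mkcond.
apply: ler_sum => e _; rewrite inE; case: eqP => [->|_] /=; first by rewrite if_same.
by case: ifP => //; have /andP[] := g01 e.1 e.2.
Qed.

Theorem theorem1p15 (R : realType) (eps : R) (heps0 : 0 < eps) (heps1 : eps < 1) :
  exists2 beta : R, 0 < beta &
    forall c : R, 0 < c ->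
    exists n0 : nat, forall n : nat, (0 < n)%N -> (n0 <= n)%N ->
    forall (T : finType) (G : sgraph T),
      #|vertices G| = n ->
      c * n%:R `^ (1 + eps) <= #|edges G|%:R ->
      exists H : sgraph T,
        [/\ subgraph H G, regular H,
            n%:R `^ beta <= #|vertices H|%:R
          & beta * c * #|vertices H|%:R `^ (1 + eps) <= #|edges H|%:R].
Proof.
(* Maximising with exponent [1 + e] leaves a factor n^e in the average degree. It is split into two
   factors n^del, one of which absorbs the constants depending on [c]. *)
pose e := eps / 2; pose del := e / 2.
have e01 : 0 < e < 1 by rewrite /e; lra.
have [e0 e1] := andP e01.
have del0 : 0 < del by rewrite /del; lra.
have [a [kap [a0 kap0 core]]] := dense_core e01.
(* [del] bounds the exponent of the size; [a / 4] arises as [H] has [r * (M / 2)] edges with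
   [r >= a * d / 2]. *)
pose beta := Num.min (a / 4) del.
have beta0 : 0 < beta by rewrite lt_min del0 andbT; lra.
have beta_a : beta <= a / 4 by rewrite ge_min lexx.
have beta_del : beta <= del by rewrite ge_min lexx orbT.
exists beta => // c c0.
have ac0 : 0 < a * c by rewrite mulr_gt0.
have kc0 : 0 < kap * c by rewrite mulr_gt0.
(* The three summands ensure the concentration bound, [2 <= kap * m] and [2 <= a * d]. *)
pose C := 1 + ((2 + del^-1) / (a * c) + 2 / (kap * c) + 2 / (a * c)).
have C1 : 0 < (2 + del^-1) / (a * c) by rewrite divr_gt0 // addr_gt0 ?invr_gt0.
have C2 : 0 < 2 / (kap * c) by rewrite divr_gt0.
have C3 : 0 < 2 / (a * c) by rewrite divr_gt0.
have [||n0 n0P] := @eventually_powR_ge R C del; rewrite /C //; first by lra.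
exists n0 => n n_gt0 n0n T G cardG edgesG.
have nR : 1 <= n%:R :> R by rewrite ler1n.
have nR0 : 0 < n%:R :> R by lra.
set y : R := n%:R `^ del; have yC : C <= y := n0P n n0n.
have y1 : 1 <= y by move: yC; rewrite /C; lra.
have ykap : 2 <= kap * c * y.
  by rewrite mulrC -ler_pdivrMr //; move: yC; rewrite /C; lra.
have ya : 2 <= a * c * y.
  by rewrite mulrC -ler_pdivrMr //; move: yC; rewrite /C; lra.
have yy : n%:R `^ e = y * y.
  by rewrite -powRD_gt0 //; congr (powR _ _); rewrite /del; lra.
have yle : y <= y * y by rewrite ler_peMr //; lra.
pose V : finType := {x : T | x \in vertices G}.
have cardV : #|[set: V]| = n by rewrite cardsT card_sig -cardG.
pose adj (x z : V) : R := (uedge (x, z) \in edges G)%:R.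
have adj01 x z : 0 <= adj x z <= 1 by rewrite /adj; case: (_ \in _); rewrite ?lexx ler01.
have adj_sym x z : adj x z = adj z x by rewrite /adj /uedge setUC.
have adj_irr x : adj x x = 0.
  rewrite /adj /uedge /= setUid; case: (boolP (_ \in _)) => // /edgesP[_].
  by rewrite cards1.
have [A cutA] := exists_large_cut adj_sym adj_irr.
pose g x z := if (x \in A) == (z \in A) then 0 else adj x z.
have g01 x z : 0 <= g x z <= 1 by rewrite /g; case: ifP => //; rewrite lexx ler01.
have g_sym x z : g x z = g z x by rewrite /g eq_sym adj_sym.
have bipA : bipartite g A by move=> x z xz; rewrite /g xz eqxx.
have g_large : #|edges G|%:R <= wt g setT setT.
  have h1 : 2 * #|edges G|%:R <= wt adj setT setT.
    rewrite /wt pair_big /=.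
    rewrite (eq_bigr (fun p => if p \in [set p | uedge p \in edges G] then 1 else 0));
      last by move=> [x z] _; rewrite inE /adj; case: (_ \in _).
    rewrite (eq_bigl xpredT); last by move=> p; rewrite !inE.
    rewrite -big_mkcond sumr_const -natrM ler_nat; exact: card_arcs_ge.
  have h2 : wt adj A (~: A) = wt g A (~: A).
    apply: eq_bigr => x xA; apply: eq_bigr => z; rewrite inE => /negbTE zA.
    by rewrite /g xA zA.
  have := wtDD g_sym (subsetT A); rewrite setTD.
  have := wt_ge0 g01 A A; have := wt_ge0 g01 (~: A) (~: A); lra.
pose phi (S : {set V}) := wt g S S / #|S|%:R `^ (1 + e).
case: (@arg_maxP _ _ _ setT predT phi isT) => W _ maxW.
have phiT : c * (y * y) <= phi setT.
  rewrite /phi cardV ler_pdivlMr ?powR_gt0 // -yy -mulrA -powRD_gt0 //.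
  apply: le_trans g_large; apply: le_trans edgesG; rewrite ler_pM2l //.
  by rewrite le_eqVlt; apply/orP; left; apply/eqP; congr (powR _ _); rewrite /e; lra.
have phiW : c * (y * y) <= phi W := le_trans phiT (maxW setT isT).
have cyy : 0 < c * (y * y) by rewrite mulr_gt0 //; lra.
have Wn0 : W != set0.
  apply/eqP => W0; move: phiW; rewrite W0 /phi /wt big_set0 mul0r; lra.
set m : R := #|W|%:R.
have m0 : 0 < m by rewrite /m ltr0n card_gt0.
have m1 : 1 <= m by rewrite /m ler1n card_gt0.
have mn : m <= n%:R by rewrite ler_nat -cardV subset_leq_card ?subsetT.
pose d := wt g W W / m.
have wW : wt g W W = d * m by rewrite /d divfK ?gt_eqF.
have me0 : 0 < m `^ e by rewrite powR_gt0.
have powS s : 0 < s -> s `^ (1 + e) = s * s `^ e :> R.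
  by move=> s0; rewrite powRD_gt0 // powRr1 // ltW.
have phiWE : phi W = d / m `^ e.
  by rewrite /phi wW powS //; field; rewrite !gt_eqF.
have d_ge : c * (y * y) * m `^ e <= d.
  by rewrite -ler_pdivlMr // -phiWE.
have me1 : 1 <= m `^ e by rewrite -(powRr0 m) ler_powR // ltW.
have d_ge1 : c * (y * y) <= d.
  by apply: le_trans d_ge; rewrite ler_peMr // ltW.
have d0 : 0 < d by apply: lt_le_trans d_ge1.
(* One factor m^e comes from the maximality of [W], the other from n^e, as [m <= n]. *)
have d_gem : c * m `^ eps <= d.
  apply: le_trans d_ge; rewrite -mulrA ler_pM2l //.
  have -> : m `^ eps = m `^ e * m `^ e.
    by rewrite -powRD_gt0 //; congr (powR _ _); rewrite /e; lra.
  by rewrite ler_pM2r // -yy ge0_ler_powR ?nnegrE // ltW.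
(* Degrees are at most [m], so the lower bound on [d] makes [m] a power of [n]. *)
have d_lem : d <= m.
  rewrite -(ler_pM2r m0) -wW; apply: wt_le => x _; rewrite wt1.
  apply: (@le_trans _ _ (\sum_(z in W) 1)); last by rewrite sumr_const.
  by apply: ler_sum => z _; have /andP[] := g01 x z.
have sparse (S : {set V}) : S \subset W ->
    wt g S S * m `^ e <= d * #|S|%:R * #|S|%:R `^ e.
  move=> _; have [->|Sn0] := eqVneq S set0.
    by rewrite {1}/wt big_set0 mul0r cards0 mulr0 mul0r.
  have s0 : 0 < #|S|%:R :> R by rewrite ltr0n card_gt0.
  have : wt g S S / #|S|%:R `^ (1 + e) <= d / m `^ e by rewrite -phiWE; apply: (maxW S).
  by rewrite ler_pdivrMr ?powR_gt0 // mulrAC ler_pdivlMr // powS // mulrA.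
have conc : 2 * #|V|%:R * expR (- (a * d)) < 1.
  rewrite -cardsT cardV.
  apply: le_lt_trans (@natr_mul_expRN_lt1 R n (a * c) del _ _ _ _ _).
  - rewrite ler_pM2l ?mulr_gt0 // ler_expR lerN2 -/y -mulrA.
    by rewrite ler_pM2l.
  - by [].
  - by [].
  - by [].
  - by [].
  - by move: yC; rewrite /C -/y; lra.
have kap_m : kap * c * (y * y) <= kap * m.
  by rewrite -mulrA ler_pM2l //; apply: le_trans d_lem.
have kapm2 : 2 <= kap * m.
  by apply: le_trans ykap (le_trans _ kap_m); rewrite ler_pM2l.
have [P [Q [PA QA PQ sz ore]]] :=
  core V g A W d g_sym g01 bipA Wn0 d0 wW sparse conc kapm2.
(* Rounding down costs at most a factor 2, as [a * d >= 2]. *)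
pose r := Num.truncn (a * d).
have ad2 : 2 <= a * d.
  apply: le_trans ya _; rewrite -mulrA ler_pM2l //.
  by apply: le_trans d_ge1; rewrite ler_pM2l.
have /andP[r_le r_gt] : r%:R <= a * d < r.+1%:R by apply: truncn_itv; lra.
rewrite -natr1 in r_gt.
have oreF : ore_condition P Q r [set x | g x.1 x.2 != 0].
  apply/ore_conditionP => X Y XP YQ.
  have [le|lt] := leqP (#|X| + #|Y|) #|P|.
    by apply: leq_trans (leq_addl _ _); rewrite leq_mul2l le orbT.
  rewrite -(ler_nat R) natrD !natrM -lerBlDr -mulrBr natrD.
  apply: le_trans (le_trans (ore X Y XP YQ) (wt_le_arcs X Y g01)).
  by apply: ler_wpM2r r_le; rewrite subr_ge0 -natrD ler_nat ltnW.
have [F [FE FPQ degP degQ]] := regular_factor PQ oreF.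
have QCP : Q \subset ~: P.
  apply: (subset_trans QA); rewrite setDE; apply: (subset_trans (subsetIr _ _)).
  by rewrite setCS; apply: (subset_trans PA); rewrite subsetIr.
have FG x : x \in F -> uedge x \in edges G.
  move=> /(subsetP FE); rewrite inE /g /adj -surjective_pairing.
  by case: ifP => _; rewrite ?eqxx //; case: (_ \in _); rewrite // eqxx.
have [H [HG regH vH eH]] := regular_subgraph_of_arcs QCP PQ FG FPQ degP degQ.
exists H; split => //; rewrite vH.
  (* Here [2 * #|vertices H| >= kap * m >= kap * c * (y * y) >= 2 * y]. *)
  apply: (@le_trans _ _ y); first by rewrite ler_powR.
  have : y * 2 <= y * (kap * c * y) by rewrite ler_pM2l //; lra.
  lra.
set M : R := (#|P| + #|Q|)%:R in sz *.
have M0 : 0 < M by move: kapm2 sz; rewrite -/m; lra.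
have Mm : M <= m.
  rewrite ler_nat -(cardsID A W) leq_add // subset_leq_card //.
have -> : #|edges H|%:R = r%:R * (M / 2) :> R.
  by rewrite eH natrM /M -PQ natrD; field.
have -> : M `^ (1 + eps) = M * M `^ eps.
  by rewrite powRD_gt0 // powRr1 // ltW.
(* As [H] has at most [m] vertices, the density of [W] at scale [m] suffices at scale [M]. *)
have Meps : c * M `^ eps <= d.
  apply: le_trans d_gem; rewrite ler_pM2l //.
  by rewrite ge0_ler_powR ?nnegrE // ltW.
have r_ge : a * d / 2 <= r%:R by lra.
have h1 : r%:R * (M / 2) >= a * d / 2 * (M / 2) by rewrite ler_pM2r // divr_gt0.
apply: le_trans h1.
have cMM : 0 <= c * M `^ eps * M by rewrite !mulr_ge0 ?powR_ge0 ?ltW.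
have h2 : beta * (c * M `^ eps * M) <= a / 4 * (c * M `^ eps * M) by rewrite ler_wpM2r.
have h3 : a / 4 * M * (c * M `^ eps) <= a / 4 * M * d.
  by rewrite ler_wpM2l // mulr_ge0 ?ltW // divr_gt0.
lra.
Qed.
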